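(* Let $H_1$ be the graph on 4 vertices consisting of a triangle $K_3$ with a pendant edge attached at one of its vertices. Then the goodness of $H_1$ is $4$; that is, the maximum $p$ such that $R(H_1,K_p) = 3(p-1)+1$ is $p = 4$.
   Context: $R(G,H)$ denotes the ordinary 2-color Ramsey number: the minimum $N$ such that every coloring of the edges of $K_N$ in red and blue contains a red copy of $G$ or a blue copy of $H$ (as a not necessarily induced subgraph). A connected graph $H$ of order $n$ (number of vertices) is called $p$-good if $R(H,K_p) = (n-1)(p-1)+1$. For a connected graph $H$ that is not a tree, the goodness of $H$ is the maximum $p$ such that $H$ is $p$-good. *)

(* Defs.v *)
From mathcomp Require Import all_boot.

Set Implicit Arguments.
Unset Strict Implicit.
Unset Printing Implicit Defensive.

Record sgraph := SGraph {
  svertex :> finType;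
  sedge : rel svertex;
  sedge_sym : symmetric sedge;
  sedge_irrefl : irreflexive sedge
}.

Arguments sedge {s}.

(* A copy is a not necessarily induced subgraph. *)
Definition has_copy (G H : sgraph) : Prop :=
  exists f : G -> H, injective f /\ {homo f : x y / sedge x y}.

Section CompleteGraph.
Variable n : nat.

Definition complete_edge : rel 'I_n := fun x y => x != y.

Lemma complete_edge_sym : symmetric complete_edge.
Proof. by move=> x y; rewrite /complete_edge eq_sym. Qed.

Lemma complete_edge_irrefl : irreflexive complete_edge.
Proof. by move=> x; rewrite /complete_edge eqxx. Qed.

Definition complete_graph : sgraph :=
  SGraph complete_edge_sym complete_edge_irrefl.
End CompleteGraph.

(* A 2-coloring of the edges of K_N assigns a color to every unordered pair
   [set x; y] with x != y (its values on other sets play no role): true is red,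
   false is blue. color_class c b is the spanning subgraph of K_N formed by the
   edges of color b. *)
Section ColorClass.
Variables (N : nat) (c : {set 'I_N} -> bool) (b : bool).

Definition color_edge : rel 'I_N :=
  fun x y => (x != y) && (c [set x; y] == b).

Lemma color_edge_sym : symmetric color_edge.
Proof. by move=> x y; rewrite /color_edge eq_sym setUC. Qed.

Lemma color_edge_irrefl : irreflexive color_edge.
Proof. by move=> x; rewrite /color_edge eqxx. Qed.

Definition color_class : sgraph := SGraph color_edge_sym color_edge_irrefl.
End ColorClass.

Definition arrows (N : nat) (G H : sgraph) : Prop :=
  forall c : {set 'I_N} -> bool,
    has_copy G (color_class c true) \/ has_copy H (color_class c false).

(* R(G, H) = N *)
Definition is_ramsey_number (G H : sgraph) (N : nat) : Prop :=
  arrows N G H /\ (forall M, arrows M G H -> N <= M).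

Definition connected_graph (G : sgraph) : Prop :=
  forall x y : G, connect sedge x y.

(* A cycle of length 2 in the sense of [ucycle] is just an edge traversed in
   both directions, hence the bound on the size. *)
Definition acyclic_graph (G : sgraph) : Prop :=
  forall s : seq G, ucycle sedge s -> size s < 3.

Definition is_tree (G : sgraph) : Prop :=
  connected_graph G /\ acyclic_graph G.

(* No graph is 0-good, despite the truncated subtraction: R(H, K_0) = 0. *)
Definition p_good (H : sgraph) (p : nat) : Prop :=
  connected_graph H /\
  is_ramsey_number H (complete_graph p) ((#|H| - 1) * (p - 1) + 1).

Definition is_goodness (H : sgraph) (g : nat) : Prop :=
  [/\ connected_graph H, ~ is_tree H, p_good H g
    & forall p, p_good H p -> p <= g].

(* The triangle 0, 1, 2 with the pendant edge from 2 to 3. *)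
Definition H1_edges : seq (nat * nat) := [:: (0, 1); (0, 2); (1, 2); (2, 3)].

Definition H1_edge : rel 'I_4 :=
  fun x y => ((val x, val y) \in H1_edges) || ((val y, val x) \in H1_edges).

Lemma H1_edge_sym : symmetric H1_edge.
Proof. by move=> x y; rewrite /H1_edge orbC. Qed.

Lemma H1_edge_irrefl : irreflexive H1_edge.
Proof. by case=> [[|[|[|[|]]]] lt_m4]. Qed.

Definition H1 : sgraph := SGraph H1_edge_sym H1_edge_irrefl.

(* Main.v *)
Require Import Defs.
From mathcomp Require Import all_boot zify.

(** Call the triangle with a pendant edge a paw, and read a coloring as its red
    graph: [H1] and [K_p] are avoided exactly when the red graph has no paw and
    all its stable sets have fewer than [p] vertices ([arrowsP]).

    Two facts about paws drive both bounds.  In a paw-free graph, a triangle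
    has no edge to any vertex outside it; and, conversely, adding a disjoint
    triangle to a paw-free graph creates no paw, while it increases the
    stability number by exactly one.

    Upper bound, [R(H1, K_4) <= 10] ([paw_free_stable]): in a triangle-free
    graph the neighbours of a vertex form a stable set, whence the classical
    bound [R(K_3, K_k) <= k (k + 1) / 2]; as long as [k <= 4], this is at most
    [3 (k - 1) + 1].  If there is a triangle, remove it, find a stable set of
    size [k - 1] in the rest by induction, and add a vertex of the triangle.

    Lower bounds ([arrowsN_add_triangle]): starting from the empty graph, adding
    three triangles gives nine vertices without a stable set of size 4, so that
    [R(H1, K_4) = 10].  Starting instead from the circulant graph on [Z/13] with
    connection set {1, 5, 8, 12}, which is triangle-free and has no stable set
    of size 5 (it shows that [R(K_3, K_5) > 13]), adding [p - 5] triangles gives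
    [13 + 3 (p - 5) = 3 (p - 1) + 1] vertices without a stable set of size [p].
    Hence [H1] is not [p]-good for any [p >= 5]. *)

Set Implicit Arguments.
Unset Strict Implicit.
Unset Printing Implicit Defensive.

Definition stable (G : sgraph) (A : {set G}) : Prop :=
  {in A &, forall x y, ~~ sedge x y}.

(** * Colorings as graphs *)

(** Allowing [G] to have more than [N] vertices builds in the monotonicity of
    arrowing, and an arbitrary vertex type makes disjoint unions available. *)
Lemma arrowsP (N p : nat) (F : sgraph) :
  arrows N F (complete_graph p) <->
  forall G : sgraph, N <= #|G| ->
    has_copy F G \/ exists2 A : {set G}, stable A & p <= #|A|.
Proof.
split=> [arrN G leNG | arrG c].
  pose h (i : 'I_N) : G := enum_val (widen_ord leNG i).
  have h_inj : injective h.
    by move=> i j /enum_val_inj/(congr1 val) eq_ij; apply: val_inj.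
  pose c (B : {set 'I_N}) := [exists x in B, exists y in B, sedge (h x) (h y)].
  have cE x y : c [set x; y] = sedge (h x) (h y).
    apply/existsP/idP => [[z /andP[zB /existsP[t /andP[tB]]]]|exy].
      by move: zB tB; rewrite !inE => /orP[]/eqP-> /orP[]/eqP->;
         rewrite ?sedge_irrefl // sedge_sym.
    exists x; rewrite !inE eqxx /=.
    by apply/existsP; exists y; rewrite !inE eqxx orbT.
  case: (arrN c) => [[f [f_inj f_hom]] | [f [f_inj f_hom]]].
    left; exists (h \o f); split; first exact: inj_comp.
    by move=> x y /f_hom/andP[_ /eqP]; rewrite cE.
  right; exists [set h (f i) | i : 'I_p].
    move=> _ _ /imsetP[i _ ->] /imsetP[j _ ->].
    have [->|neq_ij] := eqVneq i j; first by rewrite sedge_irrefl.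
    by have /andP[_ /eqP] := f_hom i j neq_ij; rewrite cE => ->.
  by rewrite card_imset ?card_ord //; apply: inj_comp.
case: (arrG (color_class c true)) => [||[A stA lepA]].
- by rewrite card_ord.
- by left.
right; pose f (i : 'I_p) : 'I_N := enum_val (widen_ord lepA i).
have f_inj : injective f.
  by move=> i j /enum_val_inj/(congr1 val) eq_ij; apply: val_inj.
exists f; split=> // i j neq_ij; rewrite /sedge /= /color_edge.
have neq_f : f i != f j by rewrite (inj_eq f_inj).
have := stA (f i) (f j) (enum_valP _) (enum_valP _).
by rewrite /sedge /= /color_edge neq_f; case: (c _).
Qed.

(** * Paws *)

Lemma paw_copyP (G : sgraph) :
  has_copy H1 G <->
  exists a b c d : G, [/\ sedge a b, sedge a c, sedge b c & sedge c d]
                      /\ (d != a) && (d != b).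
Proof.
split=> [[f [f_inj f_hom]] | [a [b [c [d [[ab ac bc cd] /andP[da db]]]]]]].
  exists (f (@Ordinal 4 0 isT)), (f (@Ordinal 4 1 isT)).
  exists (f (@Ordinal 4 2 isT)), (f (@Ordinal 4 3 isT)).
  by rewrite !(inj_eq f_inj); split=> //; split; apply: f_hom.
have neq x y : @sedge G x y -> x != y.
  by apply: contraTneq => ->; rewrite sedge_irrefl.
have us : uniq [:: a; b; c; d].
  by rewrite /= !inE !negb_or (neq _ _ ab) (neq _ _ ac) (neq _ _ bc)
             (neq _ _ cd) ![_ == d]eq_sym da db.
exists (fun i : 'I_4 => nth a [:: a; b; c; d] i); split=> [i j /eqP|].
  by rewrite nth_uniq // => /eqP/val_inj.
by move=> [[|[|[|[|?]]]] ?] [[|[|[|[|?]]]] ?] //= _; rewrite // sedge_sym.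
Qed.

(** * Stable sets in paw-free graphs *)

Section UpperBound.
Variable G : sgraph.
Implicit Types (A S : {set G}) (x y z : G).

Lemma stable_setU1 x A :
  stable A -> {in A, forall y, ~~ sedge x y} -> stable (x |: A).
Proof.
move=> stA xA y z /setU1P[->|yA] /setU1P[->|zA]; last exact: stA.
- by rewrite sedge_irrefl.
- exact: xA.
- by rewrite sedge_sym xA.
Qed.

Definition triangle_free_in S : Prop :=
  forall x y z, x \in S -> y \in S -> z \in S ->
    ~ [/\ sedge x y, sedge x z & sedge y z].

(** Either a vertex [v] has at least [k + 1] neighbours in [S], and these are
    stable; or discarding [v] and its neighbours costs at most [k + 1] vertices,
    and [v] extends any stable set found in the rest.  The sizes required thus
    grow by [k + 1], like the triangular numbers. *)
Lemma triangle_free_stable k S :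
  triangle_free_in S -> 'C(k.+1, 2) <= #|S| ->
  exists2 A, stable A & (A \subset S) && (k <= #|A|).
Proof.
elim: k S => [|k IHk] S tfS leS.
  by exists set0; rewrite ?sub0set // => x y; rewrite inE.
rewrite binS bin1 in leS.
have [v vS] : exists v, v \in S by apply/set0Pn; rewrite -card_gt0; lia.
pose N := [set y in S | sedge v y].
have NS : N \subset S by apply/subsetP=> y; rewrite inE => /andP[].
have [le_kN | lt_Nk] := leqP k.+1 #|N|.
  exists N; last by rewrite NS.
  move=> x y; rewrite !inE => /andP[xS vx] /andP[yS vy]; apply/negP=> xy.
  exact: (tfS v x y).
have vN : v \in S :\: N by rewrite !inE sedge_irrefl andbF vS.
pose S' := (S :\: N) :\ v.
have S'S : S' \subset S by apply: subset_trans (subsetDl _ _) (subsetDl _ _).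
have leS' : 'C(k.+1, 2) <= #|S'|.
  by have := cardsD1 v (S :\: N); have := cardsID N S;
     rewrite (setIidPr NS) vN -/S'; lia.
case: (IHk S' _ leS') => [x y z xS yS zS|A stA /andP[AS' leA]].
  by apply: tfS; apply: (subsetP S'S).
exists (v |: A).
  apply: stable_setU1 => // y /(subsetP AS').
  by rewrite !inE => /and3P[_ + yS]; rewrite yS.
rewrite subUset sub1set vS (subset_trans AS' S'S) /= cardsU1.
suff -> : v \notin A by [].
by apply/negP=> /(subsetP AS'); rewrite !inE eqxx.
Qed.

(** A triangle sends no edge outside, since such an edge would complete a paw;
    so any of its vertices extends any stable set avoiding the triangle. *)
Lemma paw_free_triangle_stable x y z A :
  ~ has_copy H1 G -> [/\ sedge x y, sedge x z & sedge y z] ->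
  stable A -> [disjoint A & [set x; y; z]] -> stable (x |: A).
Proof.
move=> noH1 [xy xz yz] stA dA; apply: stable_setU1 => // w wA.
apply/negP=> xw; apply: noH1; apply/paw_copyP.
exists y, z, x, w; rewrite ![sedge _ x]sedge_sym; split=> //.
have := disjointFr dA wA; rewrite !inE.
by case: (w == y); case: (w == z); rewrite ?orbT.
Qed.

(** The bound on [k] is what makes the triangular number required by the
    triangle-free case at most [3 k + 1]. *)
Lemma paw_free_stable k S :
  ~ has_copy H1 G -> k < 4 -> 3 * k < #|S| ->
  exists2 A, stable A & (A \subset S) && (k < #|A|).
Proof.
move=> noH1; elim: k S => [|k IHk] S ltk4 ltS.
  have [v vS] : exists v, v \in S by apply/set0Pn; rewrite -card_gt0; lia.
  exists [set v]; last by rewrite sub1set vS cards1.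
  by move=> x y /set1P-> /set1P->; rewrite sedge_irrefl.
case: (boolP [exists x in S, exists y in S, exists z in S,
              [&& sedge x y, sedge x z & sedge y z]]); last first.
  move=> noT; apply: triangle_free_stable.
    move=> x y z xS yS zS [xy xz yz]; case/negP: noT.
    apply/exists_inP; exists x => //; apply/exists_inP; exists y => //.
    by apply/exists_inP; exists z => //; apply/and3P.
  by apply: leq_trans ltS; case: k ltk4 {IHk} => [|[|[|]]].
case/exists_inP=> x xS /exists_inP[y yS /exists_inP[z zS /and3P[xy xz yz]]].
pose T := [set x; y; z].
have leT : #|T| <= 3.
  by rewrite /T !cardsU !cards1; lia.
have ltS' : 3 * k < #|S :\: T|.
  have := subset_leq_card (subsetIr S T); have := cardsID T S; lia.
have [A stA /andP[AS' ltA]] := IHk _ (ltnW ltk4) ltS'.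
have /andP[AS dA] : (A \subset S) && [disjoint A & T] by rewrite -subsetD.
exists (x |: A); first exact: paw_free_triangle_stable (And3 xy xz yz) stA dA.
rewrite subUset sub1set xS AS cardsU1 /=.
suff -> : x \notin A by [].
by apply/negP=> /(disjointFr dA); rewrite !inE eqxx.
Qed.

End UpperBound.

Lemma arrows_H1_K4 : arrows 10 H1 (complete_graph 4).
Proof.
apply/arrowsP => G leG.
case: (boolP [exists a : G, exists b : G, exists c : G, exists d : G,
   [&& sedge a b, sedge a c, sedge b c, sedge c d, d != a & d != b]]).
  case/existsP=> a /existsP[b /existsP[c /existsP[d /and5P[ab ac bc cd dab]]]].
  by left; apply/paw_copyP; exists a, b, c, d.
move=> noP; right.
have noH1 : ~ has_copy H1 G.
  case/paw_copyP=> a [b [c [d [[ab ac bc cd] dab]]]]; case/negP: noP.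
  apply/existsP; exists a; apply/existsP; exists b; apply/existsP; exists c.
  by apply/existsP; exists d; apply/and5P.
have [|A stA /andP[_ leA]] := @paw_free_stable G 3 setT noH1 isT.
  by rewrite cardsT.
by exists A.
Qed.

(** * Adding a disjoint triangle *)

Section DisjointUnion.
Variables G K : sgraph.

Definition union_edge : rel (G + K) := fun u v =>
  match u, v with
  | inl x, inl y => sedge x y
  | inr x, inr y => sedge x y
  | _, _ => false
  end.

Lemma union_edge_sym : symmetric union_edge.
Proof. by case=> x [y|y] //=; apply: sedge_sym. Qed.

Lemma union_edge_irrefl : irreflexive union_edge.
Proof. by case=> x; apply: sedge_irrefl. Qed.

Definition disjoint_union : sgraph :=
  SGraph union_edge_sym union_edge_irrefl.

Lemma paw_disjoint_union :
  has_copy H1 disjoint_union -> has_copy H1 G \/ has_copy H1 K.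
Proof.
case/paw_copyP=> [[a|a] [[b|b] [[c|c] [[d|d] [[//= ab ac bc cd] dab]]]]].
  by left; apply/paw_copyP; exists a, b, c, d.
by right; apply/paw_copyP; exists a, b, c, d.
Qed.

Lemma stable_disjoint_union (A : {set disjoint_union}) :
  stable A -> [/\ stable (inl @^-1: A : {set G}), stable (inr @^-1: A : {set K})
    & #|A| = #|(inl @^-1: A : {set G})| + #|(inr @^-1: A : {set K})|].
Proof.
move=> stA; split=> [x y|x y|].
- by rewrite !inE => xA yA; apply: (stA (inl x) (inl y)).
- by rewrite !inE => xA yA; apply: (stA (inr x) (inr y)).
rewrite -!sum1_card big_sumType /=.
by congr (_ + _); apply: eq_bigl => x; rewrite inE.
Qed.

End DisjointUnion.

Lemma arrowsN_add_triangle N p :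
  ~ arrows N H1 (complete_graph p) ->
  ~ arrows (N + 3) H1 (complete_graph p.+1).
Proof.
move=> arrN arrN3; apply: arrN; apply/arrowsP => G leG.
have {}leG : N + 3 <= #|disjoint_union G (complete_graph 3)|.
  by rewrite card_sum card_ord leq_add2r.
case/arrowsP/(_ _ leG): arrN3 => [/paw_disjoint_union[cG|[f [f_inj _]]]|].
- by left.
- by have := leq_card f f_inj; rewrite !card_ord.
case=> A /stable_disjoint_union[stG stK ->] leA; right.
exists (inl @^-1: A) => //.
suff : #|(inr @^-1: A : {set complete_graph 3})| <= 1 by lia.
apply/card_le1_eqP => x y xA yA; apply/eqP.
have := stK y x yA xA; rewrite /sedge /= /complete_edge; move/negbNE; exact.
Qed.

Lemma arrowsN_add_triangles k N p :
  ~ arrows N H1 (complete_graph p) ->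
  ~ arrows (N + 3 * k) H1 (complete_graph (p + k)).
Proof.
move=> arrN; elim: k => [|k IHk]; first by rewrite addn0 muln0 addn0.
by rewrite mulnS [3 + _]addnC addnA (addnS p); apply: arrowsN_add_triangle.
Qed.

(** * The circulant graph on 13 vertices *)

(** The connection set is the group of nonzero cubes modulo 13; it is closed
    under negation and sum-free. *)
Definition circulant13_adj (i j : nat) : bool :=
  (i + (13 - j)) %% 13 \in [:: 1; 5; 8; 12].

Definition circulant13_edge : rel 'I_13 := fun i j => circulant13_adj i j.

Lemma all_ord (n : nat) (P : pred nat) (i : 'I_n) : all P (iota 0 n) -> P i.
Proof. by move/allP; apply; rewrite mem_iota ltn_ord. Qed.

Lemma circulant13_edge_sym : symmetric circulant13_edge.
Proof.
have H : all (fun i => all (fun j => circulant13_adj i j == circulant13_adj j i)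
                (iota 0 13)) (iota 0 13) by vm_compute.
by move=> i j; apply/eqP; apply: (all_ord j (all_ord i H)).
Qed.

Lemma circulant13_edge_irrefl : irreflexive circulant13_edge.
Proof.
have H : all (fun i => ~~ circulant13_adj i i) (iota 0 13) by vm_compute.
by move=> i; apply/negbTE/(all_ord i H).
Qed.

Definition circulant13 : sgraph :=
  SGraph circulant13_edge_sym circulant13_edge_irrefl.

Lemma circulant13_triangle_free (x y z : circulant13) :
  sedge x y -> sedge x z -> ~~ sedge y z.
Proof.
have H : all (fun i => all (fun j => circulant13_adj i j ==>
           all (fun k => circulant13_adj i k ==> ~~ circulant13_adj j k)
             (iota 0 13)) (iota 0 13)) (iota 0 13) by vm_compute.
move=> xy xz.
have := implyP (all_ord y (all_ord x H)) xy => Hxy.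
exact: implyP (all_ord z Hxy) xz.
Qed.

Definition nonadj (i j : nat) : bool := (i != j) && ~~ circulant13_adj i j.

(** A depth-first search, which only ever branches from stable sequences: far
    fewer than the [13 ^ 5] sequences of five vertices. *)
Fixpoint no_stable_extension (k : nat) (s : seq nat) : bool :=
  if k is k'.+1 then
    (* A conditional, since the arguments of ==> are all evaluated: an early
       failure has to cut off the branch. *)
    all (fun i => if all (nonadj i) s then no_stable_extension k' (i :: s)
                  else true) (iota 0 13)
  else false.

Lemma no_stable_extensionP k s t :
  no_stable_extension k s -> size t = k -> {in t, forall i, i < 13} ->
  ~~ pairwise nonadj (rev t ++ s).
Proof.
elim: k s t => [|k IHk] s [|i t] // /allP noext [size_t] lt13.
rewrite rev_cons cat_rcons; apply/negP => pw.
have i_s : all (nonadj i) s.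
  by move: pw; rewrite pairwise_cat => /and3P[_ _ /andP[]].
have /noext : i \in iota 0 13.
  by rewrite mem_iota; apply: lt13; rewrite mem_head.
rewrite i_s => noext_i.
suff /negP : ~~ pairwise nonadj (rev t ++ i :: s) by apply.
by apply: IHk => // j jt; apply: lt13; rewrite inE jt orbT.
Qed.

(** By rotation it suffices that the eight non-neighbours 2, 3, 4, 6, 7, 9, 10,
    11 of the vertex 0 contain no stable set of size 4.  Among them the edges
    form the 8-cycle 2 3 4 9 10 11 6 7 and its chords 2 10 and 3 11.  The only
    stable sets of size 4 in the cycle are the two alternating ones, and each
    contains both ends of a chord.  The search is small enough to be run without using the rotations. *)
Lemma no_stable_extension5 : no_stable_extension 5 [::].
Proof. by vm_compute. Qed.

Lemma circulant13_stable (A : {set circulant13}) : stable A -> #|A| < 5.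
Proof.
move=> stA; rewrite ltnNge cardE; apply/negP=> leA.
pose r : seq 'I_13 := rev (take 5 (enum A)).
have size_r : size (map val r) = 5 by rewrite size_map size_rev size_takel.
have lt13 : {in map val r, forall i, i < 13}.
  by move=> _ /mapP[i _ ->]; apply: ltn_ord.
have /negP := no_stable_extensionP no_stable_extension5 size_r lt13; apply.
rewrite cats0 -map_rev revK pairwise_map.
have r_uniq : uniq (take 5 (enum A)) by rewrite take_uniq ?enum_uniq.
rewrite uniq_pairwise in r_uniq.
move: r_uniq; apply: (@sub_in_pairwise _ [in A]) => [i j iA jA /= neq_ij|].
  by apply/andP; split; [exact: neq_ij | exact: stA iA jA].
by apply/allP=> i /mem_take; rewrite mem_enum.
Qed.

Lemma arrowsN_13 : ~ arrows 13 H1 (complete_graph 5).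
Proof.
case/arrowsP/(_ circulant13); first by rewrite card_ord.
  case/paw_copyP=> a [b [c [d [[ab ac bc _] _]]]].
  by have := circulant13_triangle_free ab ac; rewrite bc.
by case=> A /circulant13_stable; rewrite ltnNge => /negP.
Qed.

(** * The goodness of the paw *)

Lemma arrowsN_0 : ~ arrows 0 H1 (complete_graph 1).
Proof.
case/arrowsP/(_ (complete_graph 0)) => // [[f _]|[A _]].
  by case: (f (@Ordinal 4 0 isT)).
by rewrite leqNgt ltnS (leq_trans (max_card _)) // card_ord.
Qed.

Lemma connected_H1 : connected_graph H1.
Proof.
have hub (x : H1) : connect sedge x (@Ordinal 4 2 isT).
  by case: x => [[|[|[|[|?]]]] ?] //;
     first [exact: connect1 | exact: eq_connect0 (val_inj _)].
move=> x y; apply: connect_trans (hub x) _.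
by rewrite (sym_connect_sym (@sedge_sym H1)) hub.
Qed.

Lemma H1_not_tree : ~ is_tree H1.
Proof.
move=> [_ acH1].
by have := acH1 [:: @Ordinal 4 0 isT; @Ordinal 4 1 isT; @Ordinal 4 2 isT] isT.
Qed.

Theorem proposition13 : is_goodness H1 4.
Proof.
split; [exact: connected_H1 | exact: H1_not_tree | split |].
- exact: connected_H1.
- rewrite card_ord; split; first exact: arrows_H1_K4.
  move=> M arrM; rewrite leqNgt; apply/negP; rewrite addn1 ltnS => leM.
  apply: (@arrowsN_add_triangles 3 0 1 arrowsN_0).
  by apply/arrowsP => G leG; move/arrowsP: arrM; apply; apply: leq_trans leG.
- move=> p [_ [+ _]]; rewrite card_ord leqNgt => arrp; apply/negP => lt4p.
  apply: (@arrowsN_add_triangles (p - 5) 13 5 arrowsN_13).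
  rewrite subnKC //.
  by have -> : 13 + 3 * (p - 5) = (4 - 1) * (p - 1) + 1 by lia.
Qed.
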